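(* Let $\mathbf R=(R_0,R_1,\dots)$ be an exponential Dowling structure (for a group of order $s$) with denominator sequence $(N(0),N(1),\dots)$ and associated exponential structure $\mathbf Q=(Q_1,Q_2,\dots)$ with denominator sequence $(M(1),M(2),\dots)$. Let $f:\mathbb P\to\mathbb C$, $g:\mathbb N\to\mathbb C$ and $k:\mathbb N\to\mathbb C$ be functions, and for $n\ge0$ define $$h(n)=\sum_{x\in R_n}k(b)\cdot f(1)^{a_1}f(2)^{a_2}\cdots f(n)^{a_n}\cdot g(a_1+\cdots+a_n),$$ where $(b;a_1,\dots,a_n)$ is the type of $x$. Define formal power series $F(x)=\sum_{n\ge1}f(n)\frac{x^n}{M(n)\,n!}$, $G(x)=\sum_{n\ge0}g(n)\frac{x^n}{n!}$, $K(x)=\sum_{n\ge0}k(n)\frac{x^n}{N(n)\,n!}$, $H(x)=\sum_{n\ge0}h(n)\frac{x^n}{N(n)\,n!}$. Then $$H(x)=K(x)\cdot G\!\left(\tfrac1s F(s\cdot x)\right).$$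
   Context: $\mathbb P$ denotes the positive integers and $\mathbb N$ the nonnegative integers. Dowling lattice: fix a finite group $G$ of order $s$. For $n\ge0$, $L_n$ has as elements pairs $(\tilde\pi,Z)$ with $Z\subseteq\{1,\dots,n\}$ (zero block) and $\tilde\pi$ a set partition of $\{1,\dots,n\}\setminus Z$ whose blocks $B$ are enriched by functions $f:B\to G$ taken up to right multiplication by a constant in $G$. The order is generated by the covers: (i) a block is removed from $\tilde\pi$ and added to $Z$; (ii) two enriched blocks $(B,f),(C,g)$ are replaced by $(B\cup C,h)$ with $h=f$ on $B$ and $h=\alpha\cdot g$ on $C$ for some $\alpha\in G$. $L_n$ is graded of rank $n$. Partition lattice $\Pi_n$: set partitions of $\{1,\dots,n\}$ ordered by refinement. Exponential structure: a sequence $\mathbf Q=(Q_1,Q_2,\dots)$ of finite posets such that (E1) $Q_n$ has a unique maximal element $\hat1$ and every maximal chain of $Q_n$ has $n$ elements; (E2) for $x\in Q_n$ of rank $k$, $[x,\hat1]\cong\Pi_{n-k}$; (E3) the lower order ideal generated by $x\in Q_n$ is isomorphic to $Q_1^{a_1}\times\cdots\times Q_n^{a_n}$ for some nonnegative integers $(a_1,\dots,a_n)$, the type of $x$; (E4) $M(n)$ is the number of minimal elements of $Q_n$. Exponential Dowling structure associated to $\mathbf Q$: a sequence $\mathbf R=(R_0,R_1,\dots)$ of finite posets such that (D1) $R_n$ has a unique maximal element $\hat1$ and every maximal chain of $R_n$ has $n+1$ elements (rank function $\rho$); (D2) for $x\in R_n$, $[x,\hat1]\cong L_{n-\rho(x)}$;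 (D3) each $x\in R_n$ is assigned a type $(b;a_1,\dots,a_n)$ of nonnegative integers such that the lower order ideal generated by $x$ is isomorphic to $R_b\times Q_1^{a_1}\times\cdots\times Q_n^{a_n}$; (D4) $N(n)$ is the number of minimal elements of $R_n$.
   Formalization: The type of x is required to agree with the Dowling lattice type under an isomorphism of [m,1̂] with L_n for each minimal m (with (D3) alone types are not determined and the formula fails); in cover (ii), h = g·α on C instead of α·g. *)

(* Defs.v *)
From HB Require Import structures.
From mathcomp Require Import all_boot all_order all_algebra all_fingroup.

Set Implicit Arguments.
Unset Strict Implicit.
Unset Printing Implicit Defensive.

Import Order.TTheory.
Local Open Scope order_scope.

Definition order_iso d d' (P : porderType d) (P' : porderType d') : Prop :=
  exists2 f : P -> P', bijective f & {mono f : x y / x <= y}.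

Section Posets.
Context {d : Order.disp_t} {P : finPOrderType d}.
Implicit Types (x y : P) (C : {set P}).

Definition is_chain C := [forall x in C, forall y in C, x >=< y].
Definition maximal_chain C := maxset is_chain C.

Definition minimal x := [forall y, (y <= x) ==> (y == x)].
Definition maximal x := [forall y, (x <= y) ==> (y == x)].

(* The rank of x is the length of a longest chain strictly below it: minimal
   elements have rank 0. *)
Definition rank x := \max_(C : {set P} | is_chain C && [forall y in C, y < x]) #|C|.

Definition nb_minimal := #|[set x : P | minimal x]|.

Record lower_ideal x := LowerIdeal { lower_val :> P; _ : lower_val <= x }.
(* In a finite poset with a unique maximal element \hat 1, this is the
   interval [x, \hat 1]. *)
Record upper_ideal x := UpperIdeal { upper_val :> P; _ : x <= upper_val }.

HB.instance Definition _ x := [isSub for @lower_val x].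
HB.instance Definition _ x := [Finite of lower_ideal x by <:].
HB.instance Definition _ x :=
  [SubChoice_isSubPOrder of lower_ideal x by <: with d].
HB.instance Definition _ x := [isSub for @upper_val x].
HB.instance Definition _ x := [Finite of upper_ideal x by <:].
HB.instance Definition _ x :=
  [SubChoice_isSubPOrder of upper_ideal x by <: with d].

End Posets.
Arguments nb_minimal {d} P.

Section BigProduct.
Context {d : Order.disp_t} {I : finType} (T : I -> finPOrderType d).

Definition prod_poset := {dffun forall i : I, T i}.
HB.instance Definition _ := Finite.on prod_poset.

Definition prod_le (u v : prod_poset) := [forall i, u i <= v i].

Fact prod_le_refl : reflexive prod_le.
Proof. by move=> u; apply/forallP. Qed.

Fact prod_le_anti : antisymmetric prod_le.
Proof.
move=> u v /andP[/forallP uv /forallP vu]; apply/ffunP => i.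
by apply/le_anti; rewrite uv vu.
Qed.

Fact prod_le_trans : transitive prod_le.
Proof.
move=> v u w /forallP uv /forallP vw; apply/forallP => i.
exact: le_trans (uv i) (vw i).
Qed.

HB.instance Definition _ :=
  Order.Le_isPOrder.Build d prod_poset prod_le_refl prod_le_anti prod_le_trans.

End BigProduct.

(* Q_1^{a_1} x ... x Q_n^{a_n} *)
Definition power_product d (Q : nat -> finPOrderType d) n (a : nat -> nat) :=
  prod_poset (fun p : {i : 'I_n & 'I_(a i.+1)} => Q (tag p).+1).

Record set_partition n := SetPartition
  { blocks :> {set {set 'I_n}}; _ : partition blocks [set: 'I_n] }.
HB.instance Definition _ n := [isSub for @blocks n].
HB.instance Definition _ n := [Finite of set_partition n by <:].

Section PartitionLattice.
Variable n : nat.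
Implicit Types p q r : set_partition n.

Definition refines p q :=
  [forall B in blocks p, [exists C in blocks q, B \subset C]].

Fact refines_refl : reflexive refines.
Proof.
by move=> p; apply/forall_inP => B pB; apply/exists_inP; exists B.
Qed.

Fact refines_trans : transitive refines.
Proof.
move=> q p r /forall_inP pq /forall_inP qr; apply/forall_inP => B /pq.
case/exists_inP => C /qr/exists_inP[D rD CD] BC.
by apply/exists_inP; exists D => //; apply: subset_trans CD.
Qed.

Fact refines_anti : antisymmetric refines.
Proof.
suff sub p q : refines p q -> refines q p -> blocks p \subset blocks q.
  move=> p q /andP[pq qp]; apply/val_inj/eqP.
  by rewrite eqEsubset /= !sub.
move=> /forall_inP pq /forall_inP qp; apply/subsetP => B pB.
have /exists_inP[C qC BC] := pq _ pB.
have /exists_inP[D pD CD] := qp _ qC.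
have /and3P[_ /trivIsetP tp p0] := valP p.
have [x Bx] : exists x, x \in B.
  by apply/set0Pn; apply: contraNneq p0 => <-.
have BD : B = D.
  apply: contraTeq Bx => /(tp _ _ pB pD) /pred0P /(_ x) /= /negbT.
  rewrite negb_and => /orP[//|]; apply: contra => Bx.
  exact: (subsetP CD) _ ((subsetP BC) _ Bx).
suff -> : B = C by [].
by apply/eqP; rewrite eqEsubset BC BD.
Qed.

HB.instance Definition _ := Order.Le_isPOrder.Build (Order.Disp tt tt)
  (set_partition n) refines_refl refines_anti refines_trans.

End PartitionLattice.

Section Dowling.
Variables (gT : finGroupType) (n : nat).

(* A function B -> G is a partial function on 'I_n with support B. *)
Notation pfun := {ffun 'I_n -> option gT}.

Definition supp (f : pfun) : {set 'I_n} := [set i | f i != None].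

Definition rmul (f : pfun) (c : gT) : pfun :=
  [ffun i => omap (fun a => a * c)%g (f i)].

Definition rclass (f : pfun) : {set pfun} := [set rmul f c | c : gT].

(* A pair (B, F) of a block B and a class F of functions B -> G. *)
Definition eblock := ({set 'I_n} * {set pfun})%type.

Definition is_eblock (e : eblock) :=
  (e.1 != set0) && [exists f : pfun, (supp f == e.1) && (e.2 == rclass f)].

Definition is_dowling (x : {set eblock} * {set 'I_n}) :=
  [&& [forall e in x.1, is_eblock e],
      [forall e in x.1, forall e' in x.1, (e.1 == e'.1) ==> (e == e')] &
      partition [set e.1 | e in x.1] (~: x.2)].

Record dowling := MkDowling
  { dowling_val : {set eblock} * {set 'I_n}; _ : is_dowling dowling_val }.
HB.instance Definition _ := [isSub for dowling_val].
HB.instance Definition _ := [Finite of dowling by <:].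

Implicit Types x y : dowling.

Definition nonzero_blocks x : {set eblock} := (dowling_val x).1.
Definition zero_block x : {set 'I_n} := (dowling_val x).2.

(* Since functions are taken up to multiplication on the right, the factor
   alpha also has to be on the right: the classes obtained by merging two
   enriched blocks then do not depend on the representatives f and g, and this
   is Dowling's lattice also for a non-commutative group. *)
Definition merge_eblock (B C : {set 'I_n}) (f g : pfun) (alpha : gT) : eblock :=
  (B :|: C, rclass [ffun i => if i \in B then f i else rmul g alpha i]).

Definition cover_zero x y :=
  [exists e in nonzero_blocks x,
    (nonzero_blocks y == nonzero_blocks x :\ e) &&
    (zero_block y == e.1 :|: zero_block x)].

Definition cover_merge x y :=
  [exists e1 in nonzero_blocks x, exists e2 in nonzero_blocks x,
    [&& e1 != e2,
        [exists f in e1.2, exists g in e2.2, exists alpha : gT,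
          nonzero_blocks y ==
            merge_eblock e1.1 e2.1 f g alpha |: (nonzero_blocks x :\ e1 :\ e2)] &
        zero_block y == zero_block x]].

Definition dowling_cover : rel dowling :=
  [rel x y | cover_zero x y || cover_merge x y].

Definition dowling_le : rel dowling := connect dowling_cover.

Fact dowling_cover_card x y : dowling_cover x y ->
  (#|nonzero_blocks y| < #|nonzero_blocks x|)%N.
Proof.
case/orP.
  case/exists_inP => e xe /andP[/eqP-> _].
  by rewrite [leqRHS](cardsD1 e) xe.
case/exists_inP => e1 xe1 /exists_inP[e2 xe2 /and3P[ne12 /exists_inP[f _]]].
case/exists_inP=> g _ /existsP[alpha /eqP->] _.
have xe2' : e2 \in nonzero_blocks x :\ e1 by rewrite !inE eq_sym ne12.
rewrite [ltnRHS](cardsD1 e1) xe1 [X in (_ < _ + X)%N](cardsD1 e2) xe2' /=.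
by rewrite cardsU1 !add1n !ltnS -add1n leq_add2r leq_b1.
Qed.

Fact dowling_le_card x y : dowling_le x y ->
  x = y \/ (#|nonzero_blocks y| < #|nonzero_blocks x|)%N.
Proof.
case/connectP => s; elim: s x => [|z s IH] x /= => [_ ->|]; first by left.
case/andP => /dowling_cover_card xz zs ys; right.
by case: (IH _ zs ys) => [<-//|zy]; apply: ltn_trans xz.
Qed.

Fact dowling_le_refl : reflexive dowling_le.
Proof. by move=> x; apply: connect0. Qed.

Fact dowling_le_trans : transitive dowling_le.
Proof. by move=> y x z; apply: connect_trans. Qed.

Fact dowling_le_anti : antisymmetric dowling_le.
Proof.
move=> x y /andP[/dowling_le_card[//|yx] /dowling_le_card[//|xy]].
by have := ltn_trans xy yx; rewrite ltnn.
Qed.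

HB.instance Definition _ := Order.Le_isPOrder.Build (Order.Disp tt tt)
  dowling dowling_le_refl dowling_le_anti dowling_le_trans.

(* The type (b; a_1, ..., a_n) of an element of the Dowling lattice. *)
Definition dowling_b x := #|zero_block x|.
Definition dowling_a x i := #|[set e in nonzero_blocks x | #|e.1| == i]|.

End Dowling.

(* Only Q 1, Q 2, ... matter; Q 0 is a dummy entry. *)
Record exponential_structure d (Q : nat -> finPOrderType d) : Prop := {
  exp_top : forall n, (0 < n)%N -> exists! t : Q n, maximal t;
  exp_chain : forall n (C : {set Q n}), (0 < n)%N ->
    maximal_chain C -> #|C| = n;
  exp_upper : forall n (x : Q n), (0 < n)%N ->
    order_iso (upper_ideal x) (set_partition (n - rank x));
  exp_lower : forall n (x : Q n), (0 < n)%N ->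
    exists a : nat -> nat, order_iso (lower_ideal x) (power_product Q n a)
}.

(* The type of x : R n is (tb n x; ta n x 1, ..., ta n x n). The isomorphism
   type of the lower ideal of x does not determine it: Q 1 is a point, so that
   ta n x 1 would be arbitrary, and R 1 can be isomorphic to Q 2. The last field
   says that, above any minimal element m of R n, types are those of the Dowling
   lattice under an isomorphism of [m, \hat 1] with it. *)
Record exponential_dowling_structure (gT : finGroupType)
    dQ (Q : nat -> finPOrderType dQ) dR (R : nat -> finPOrderType dR)
    (tb : forall n, R n -> nat) (ta : forall n, R n -> nat -> nat) : Prop := {
  dow_top : forall n, exists! t : R n, maximal t;
  dow_chain : forall n (C : {set R n}), maximal_chain C -> #|C| = n.+1;
  dow_upper : forall n (x : R n),
    order_iso (upper_ideal x) (dowling gT (n - rank x));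
  dow_lower : forall n (x : R n),
    order_iso (lower_ideal x) (R (tb n x) *p power_product Q n (ta n x))%type;
  dow_type : forall n (m : R n), minimal m ->
    exists phi : upper_ideal m -> dowling gT n,
      [/\ bijective phi,
          {mono phi : x y / x <= y} &
          forall y : upper_ideal m, tb n (val y) = dowling_b (phi y) /\
            forall i, (0 < i <= n)%N -> ta n (val y) i = dowling_a (phi y) i]
}.

Local Open Scope ring_scope.

(* A formal power series is the sequence of its coefficients. *)
Section PowerSeries.
Variable K : nzRingType.
Implicit Types A B : nat -> K.

Definition fps_one : nat -> K := fun n => (n == 0%N)%:R.
Definition fps_mul A B : nat -> K := fun n => \sum_(i < n.+1) A i * B (n - i)%N.
Definition fps_exp A m : nat -> K := iter m (fps_mul A) fps_one.
Definition fps_scale c A : nat -> K := fun n => c * A n.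
(* A(c x) *)
Definition fps_dilate c A : nat -> K := fun n => c ^+ n * A n.
(* B(A(x)) for A with zero constant term: A^m then contributes to the
   coefficient of x^n only for m <= n. *)
Definition fps_comp B A : nat -> K :=
  fun n => \sum_(m < n.+1) B m * fps_exp A m n.

End PowerSeries.

(* Main.v *)
(** An element [x] of type [(b; a_1, ..., a_n)] has N(b) M(1)^a_1 ... M(n)^a_n
    minimal elements below it. Dividing the summand of h(n) at [x] by this number
    and summing over the pairs (m, x) with [m] minimal below [x] turns h(n) into
    N(n) copies of a sum over the Dowling lattice L_n.

    An element of L_n is a zero block together with a set of enriched blocks
    partitioning its complement, and a block of size j carries s^(j-1) classes of
    functions. The exponential formula for partitions into enriched blocks is
    proved by induction on their number m: marking one of the blocks shows that
    the weighted sums E(A, m) over the sets A satisfy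
    (m + 1) E(A, m + 1) = \sum_e w(e) E(A \ e, m). *)
Require Import Defs.
From mathcomp Require Import all_boot all_order all_algebra all_fingroup.
From mathcomp Require Import boolp reals complex ring.

Set Implicit Arguments.
Unset Strict Implicit.
Unset Printing Implicit Defensive.

Import Order.TTheory GRing.Theory Num.Theory.
Local Open Scope ring_scope.

(** * Partitions into blocks that carry structure, and their exponential formula *)

Section StructuredPartitions.
Variables (T E : finType) (c : E -> {set T}) (V : pred E).
Hypothesis supportV : forall e, V e -> c e != set0.
Implicit Types (A B : {set T}) (X Y : {set E}).

(* With [c := fst] and [V := @is_eblock gT n], this is [is_dowling (X, ~: A)] up
   to the double complement. *)
Definition structured_partition X A :=
  [&& [forall e in X, V e],
      [forall e in X, forall e' in X, (c e == c e') ==> (e == e')] &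
      partition [set c e | e in X] A].

Lemma structured_partitionP X A :
  reflect [/\ {in X, forall e, V e}, {in X &, injective c} &
              partition [set c e | e in X] A] (structured_partition X A).
Proof.
apply: (iffP and3P) => -[XV Xinj XA]; split=> //.
- by move=> e Xe; apply: (forall_inP XV).
- move=> e e' Xe Xe' /eqP cee'.
  by apply/eqP; have /forall_inP/(_ _ Xe')/implyP := forall_inP Xinj _ Xe; apply.
- by apply/forall_inP.
- apply/forall_inP => e Xe; apply/forall_inP => e' Xe'.
  by apply/implyP => /eqP cee'; apply/eqP/Xinj.
Qed.

Lemma structured_partitionD1 X A e : e \in X -> structured_partition X A ->
  [/\ V e, c e \subset A & structured_partition (X :\ e) (A :\: c e)].
Proof.
move=> Xe /structured_partitionP[XV Xinj XA]; split.
- exact: XV.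
- by rewrite -(cover_partition XA); apply: (bigcup_sup (c e)) => //; apply: imset_f.
apply/structured_partitionP; split.
- by move=> e' /setD1P[_ /XV].
- by apply: sub_in2 Xinj => e' /setD1P[].
suff -> : [set c e' | e' in X :\ e] = [set c e' | e' in X] :\ c e.
  by apply: partitionD1 => //; apply: imset_f.
apply/setP => B; rewrite !inE; apply/imsetP/andP.
  case=> e' /setD1P[e'e Xe'] ->; rewrite imset_f //; split=> //.
  by apply: contraNneq e'e => /Xinj ->.
case=> Be /imsetP[e' Xe' defB]; exists e' => //.
by rewrite !inE Xe' andbT; apply: contraNneq Be => <-; rewrite defB.
Qed.

(** Inverse of the removal in [structured_partitionD1]. No block of [Y] shares its support with [e]:
    that support would be nonempty and lie both in [c e] and in its complement. *)
Lemma structured_partitionU1 Y A e : V e -> c e \subset A ->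
    structured_partition Y (A :\: c e) ->
  structured_partition (e |: Y) A /\ e \notin Y.
Proof.
move=> Ve eA /structured_partitionP[YV Yinj YA].
have dis : [disjoint c e & A :\: c e].
  by rewrite disjoint_sym disjoints_subset subsetDr.
have neq e' : e' \in Y -> c e <> c e'.
  move=> Ye' ee'; have [x ex] := set0Pn _ (supportV Ve).
  suff : x \in A :\: c e by rewrite inE ex.
  rewrite -(cover_partition YA); apply/bigcupP; exists (c e'); first exact: imset_f.
  by rewrite -ee'.
split; last by apply/negP => /neq.
apply/structured_partitionP; split.
- by move=> e' /setU1P[->|/YV].
- move=> e1 e2 /setU1P[->|Y1] /setU1P[->|Y2] //.
  + by move/neq => /(_ Y2).
  + by move/esym/neq => /(_ Y1).
  + exact: Yinj.
rewrite imsetU1 -[A in partition _ A](setID A (c e)) (setIidPr eA).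
by apply: partitionU1 => //; apply: supportV.
Qed.

Lemma structured_partition_set0 A : structured_partition set0 A = (A == set0).
Proof.
apply/structured_partitionP/eqP => [[_ _]|->].
  by rewrite imset0 => /cover_partition <-; rewrite /cover big_set0.
by split=> [e|e e'|]; rewrite ?inE // imset0 partition_set0.
Qed.

(** Disjoint nonempty supports use at least one point each. This bound lets the truncated sum in
    [fps_comp] capture every number of blocks. *)
Lemma structured_partition_card X A : structured_partition X A -> (#|X| <= #|A|)%N.
Proof.
case/structured_partitionP => XV Xinj XA; rewrite (card_partition XA) -sum1_card.
rewrite big_imset //=; apply: leq_sum => e Xe.
by rewrite card_gt0; apply/supportV/XV.
Qed.

Variables (K : numFieldType) (w : E -> K) (omega : nat -> K).
Hypothesis sum_omega :
  forall B, \sum_(e | V e && (c e == B)) w e = omega #|B|.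

Definition structured_sum A m :=
  \sum_(X | structured_partition X A && (#|X| == m)) \prod_(e in X) w e.

Lemma structured_sum_rec A m :
  m.+1%:R * structured_sum A m.+1 =
  \sum_(B in powerset A) omega #|B| * structured_sum (A :\: B) m.
Proof.
(* The factor [m.+1] counts the choices of the marked element [e] of [X]. *)
transitivity (\sum_(X | structured_partition X A && (#|X| == m.+1))
    \sum_(e in X) w e * \prod_(e' in X :\ e) w e').
  rewrite mulr_sumr; apply: eq_bigr => X /andP[_ /eqP cardX].
  rewrite -cardX mulr_natl -sumr_const; apply: eq_bigr => e Xe.
  by rewrite (big_setD1 e Xe).
rewrite (exchange_big_dep predT) //=.
transitivity (\sum_(e | V e && (c e \subset A)) w e * structured_sum (A :\: c e) m).
  rewrite [RHS]big_mkcond /=; apply: eq_bigr => e _.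
  case: ifP => [/andP[Ve eA]|nVe]; last first.
    rewrite big_pred0 // => X; apply/negP => /andP[/andP[XA _] Xe].
    by have [Ve eA _] := structured_partitionD1 Xe XA; rewrite Ve eA in nVe.
  (* Removing the marked [e] is a bijection onto the structured partitions of [A :\: c e]. *)
  rewrite mulr_sumr (reindex_onto (fun Y => e |: Y) (fun X => X :\ e)) /=; last first.
    by move=> X /andP[_ Xe]; rewrite setD1K.
  apply: eq_big => [Y|Y /andP[_ /eqP->]//].
  apply/idP/idP.
    case/andP=> /andP[/andP[XA cX] Xe] /eqP eY.
    have [_ _ YA] := structured_partitionD1 Xe XA.
    rewrite eY in YA; rewrite YA /=.
    have := cardsD1 e (e |: Y); rewrite Xe eY (eqP cX) add1n.
    by case=> ->.
  case/andP=> YA cY; have [XA eY] := structured_partitionU1 Ve eA YA.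
  by rewrite XA setU11 cardsU1 eY (eqP cY) setU1K ?eqxx.
(* Marked elements with the same support [B] leave the same remainder, so their weights add up to
   [omega #|B|]. *)
rewrite (partition_big c (mem (powerset A))) /=; last first.
  by move=> e /andP[_]; rewrite inE.
apply: eq_bigr => B; rewrite inE => BA.
rewrite -sum_omega mulr_suml; apply: eq_big => [e|e /andP[_ /eqP->]//].
by case: eqP => [->|]; rewrite ?BA ?andbT ?andbF.
Qed.

Lemma sum_powerset_card A (u : nat -> K) :
  \sum_(B in powerset A) u #|B| = \sum_(j < #|A|.+1) 'C(#|A|, j)%:R * u j.
Proof.
rewrite (partition_big (fun B => inord #|B| : 'I_#|A|.+1) predT) //=.
apply: eq_bigr => j _; rewrite mulr_natl -cards_draws -sumr_const.
apply: eq_big => [B|B]; rewrite !inE; last first.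
  by case/andP=> BA /eqP <-; rewrite inordK // ltnS subset_leq_card.
case: (boolP (B \subset A)) => //= BA.
by rewrite -(inj_eq val_inj) /= inordK // ltnS subset_leq_card.
Qed.

Lemma structured_sumE A m : structured_sum A m =
  #|A|`!%:R / m`!%:R * fps_exp (fun j => omega j / j`!%:R) m #|A|.
Proof.
have fact_neq0 j : j`!%:R != 0 :> K by rewrite pnatr_eq0 -lt0n fact_gt0.
elim: m A => [|m IHm] A.
  rewrite /structured_sum /= /fps_one; have [-> | A0] := eqVneq A set0.
    rewrite (big_pred1 set0) => [|X]; last first.
      rewrite cards_eq0 /=; case: eqVneq => [->|_]; last by rewrite andbF.
      by rewrite structured_partition_set0 eqxx.
    by rewrite big_set0 cards0 mulr1 divff.
  rewrite cards_eq0 (negPf A0) mulr0 big_pred0 // => X; apply/negP.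
  rewrite cards_eq0 => /andP[+ /eqP eX]; rewrite eX structured_partition_set0.
  exact/negP.
apply: (@mulfI _ m.+1%:R); first by rewrite pnatr_eq0.
rewrite structured_sum_rec.
transitivity (\sum_(B in powerset A) omega #|B| * ((#|A| - #|B|)`!%:R / m`!%:R *
   fps_exp (fun j => omega j / j`!%:R) m (#|A| - #|B|)%N)).
  by apply: eq_bigr => B; rewrite inE => BA; rewrite IHm cardsDS.
rewrite (sum_powerset_card A (fun j => omega j * ((#|A| - j)`!%:R / m`!%:R *
   fps_exp (fun j => omega j / j`!%:R) m (#|A| - j)%N))).
rewrite /= /fps_mul !mulr_sumr; apply: eq_bigr => j _.
(* Expanding the factorial of [#|A|] cancels the binomial coefficient and turns the recursion into a
   Cauchy product. *)
rewrite -(bin_fact (ltn_ord j : j <= #|A|)%N) factS !natrM.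
have := fact_neq0 j; have := fact_neq0 m.
have : m.+1%:R != 0 :> K by rewrite pnatr_eq0.
move: (m.+1%:R) (m`!%:R) (j`!%:R) => x y z x0 y0 z0.
by field; rewrite x0 y0 z0.
Qed.
End StructuredPartitions.

Lemma big_subtype (R : Type) (idx : R) (op : Monoid.com_law idx) (I : finType)
    (P : pred I) (J : subFinType P) (F : I -> R) :
  \big[op/idx]_(j : J) F (val j) = \big[op/idx]_(i | P i) F i.
Proof.
rewrite [RHS](@reindex_omap _ _ _ _ J val insub) => [|i Pi]; last first.
  by rewrite insubT /= SubK.
by apply: eq_bigl => j; rewrite valP valK eqxx.
Qed.

(** * Counting the enriched blocks on a given set *)

Section EnrichedBlocks.
Variables (gT : finGroupType) (n : nat).
Notation pfun := {ffun 'I_n -> option gT}.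
Implicit Types (f : pfun) (B : {set 'I_n}).

Lemma rmul1 f : rmul f 1%g = f.
Proof. by apply/ffunP => i; rewrite ffunE; case: (f i) => //= a; rewrite mulg1. Qed.

Lemma rmulM f a b : rmul (rmul f a) b = rmul f (a * b)%g.
Proof.
by apply/ffunP => i; rewrite !ffunE; case: (f i) => //= c; rewrite mulgA.
Qed.

Lemma supp_rmul f a : supp (rmul f a) = supp f.
Proof. by apply/setP => i; rewrite !inE ffunE; case: (f i). Qed.

Lemma rclass_refl f : f \in rclass f.
Proof. by apply/imsetP; exists 1%g; rewrite ?rmul1. Qed.

Lemma rclass_rmul f a : rclass (rmul f a) = rclass f.
Proof.
apply/setP => g; apply/imsetP/imsetP => -[b _ ->].
  by exists (a * b)%g; rewrite ?rmulM.
by exists (a^-1 * b)%g; rewrite // rmulM mulKVg.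
Qed.

Lemma rclass_eq f g : (rclass f == rclass g) = (f \in rclass g).
Proof.
apply/eqP/idP => [<-|/imsetP[a _ ->]]; first exact: rclass_refl.
exact: rclass_rmul.
Qed.

(** Right multiplication acts freely: the value at one point of the support determines the
    multiplier. *)
Lemma card_rclass f : supp f != set0 -> #|rclass f| = #|gT|.
Proof.
case/set0Pn => i; rewrite inE => fi; apply: card_imset => a b /ffunP/(_ i).
by rewrite !ffunE; case: (f i) fi => //= c _ [/mulgI].
Qed.

Lemma card_supp B : #|[set f : pfun | supp f == B]| = (#|gT| ^ #|B|)%N.
Proof.
pose S i := [pred a : option gT | (a != None) == (i \in B)].
transitivity #|family S|.
  apply: eq_card => f; rewrite inE; apply/eqP/familyP => [fB i|fS].
    by rewrite inE -fB inE.
  by apply/setP => i; have := fS i; rewrite !inE => /eqP.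
rewrite card_family foldrE big_image /= -prod_nat_const [RHS]big_mkcond /=.
apply: eq_bigr => i _; case: ifP => _.
  rewrite -[RHS]/(#|gT|.+1.-1) -card_option -(cardC1 None); apply: eq_card => a.
  by rewrite !unfold_in; case: a.
rewrite -(card1 (@None gT)); apply: eq_card => a.
by rewrite !unfold_in; case: a.
Qed.

Lemma card_eblock B :
  #|[set e : eblock gT n | is_eblock e && (e.1 == B)]| =
  if #|B| is m.+1 then (#|gT| ^ m)%N else 0%N.
Proof.
have [->|B0] := eqVneq B set0.
  rewrite cards0; apply: eq_card0 => e; rewrite !inE.
  by apply/negP => /andP[/andP[/negPf e0 _]]; rewrite e0.
pose S := [set f : pfun | supp f == B].
have -> : [set e : eblock gT n | is_eblock e && (e.1 == B)] =
    pair B @: (@rclass gT n @: S).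
  apply/setP => -[C F]; rewrite !inE /is_eblock /=; apply/idP/imsetP.
    case/andP=> /andP[_ /existsP[f /andP[/eqP fC /eqP ->]]] /eqP CB.
    by exists (rclass f); rewrite ?CB // imset_f // inE fC CB.
  case=> _ /imsetP[f + ->] [-> ->]; rewrite inE B0 eqxx andbT /= => fB.
  by apply/existsP; exists f; rewrite fB eqxx.
rewrite card_imset => [|? ? []//].
(* Right multiplication preserves supports, so [S] is a disjoint union of whole classes, each of
   size [#|gT|]. *)
have: #|S| = (#|rclass (n := n) @: S| * #|gT|)%N.
  rewrite -sum1_card (partition_big_imset (@rclass gT n)) /= -sum_nat_const.
  apply: eq_bigr => F /imsetP[f]; rewrite inE => /eqP fB ->.
  rewrite sum1_card -(@card_rclass f) ?fB //; apply: eq_card => g.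
  rewrite unfold_in /= inE rclass_eq; apply: andb_idl => /imsetP[a _ ->].
  by rewrite supp_rmul fB.
rewrite card_supp; case: #|B| (card_gt0 B) => [|m _]; first by rewrite B0.
have gT_gt0 : (0 < #|gT|)%N by apply/card_gt0P; exists 1%g.
by rewrite expnSr => /eqP; rewrite eqn_pmul2r // => /eqP.
Qed.

End EnrichedBlocks.

(** Passes from expressions in the type [(a_1, ..., a_n)] to expressions in the single blocks; it
    serves both the product of the weights and the sum of the [a_i]. *)
Lemma big_card_fiber (R : Type) (idx : R) (op : Monoid.com_law idx) (I : finType)
    (X : {set I}) (sz : I -> nat) n (u : nat -> R) :
    {in X, forall e, (0 < sz e <= n)%N} ->
  \big[op/idx]_(1 <= i < n.+1) \big[op/idx]_(e in [set e in X | sz e == i]) u i =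
  \big[op/idx]_(e in X) u (sz e).
Proof.
move=> Xsz; under eq_bigr do under eq_bigl do rewrite inE.
rewrite (exchange_big_dep (mem X)) /= => [|i e _ /andP[]//].
apply: eq_bigr => e Xe.
under eq_bigl do rewrite Xe /= eq_sym.
by rewrite big_nat1_eq ltnS Xsz.
Qed.

(** * The weighted sum over the Dowling lattice *)

Section DowlingSum.
Variables (gT : finGroupType) (n : nat) (K : numFieldType).
Variables (kappa phi g : nat -> K).
Let s : K := #|gT|%:R.
Local Notation T := 'I_n.
Local Notation E := (eblock gT n).

Lemma dowling_sumE :
  \sum_(y : dowling gT n) kappa (dowling_b y) *
      (\prod_(1 <= i < n.+1) phi i ^+ dowling_a y i) *
      g (\sum_(1 <= i < n.+1) dowling_a y i)%N =
  n`!%:R * fps_mul (fun j => kappa j / j`!%:R)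
    (fps_comp (fun m => g m / m`!%:R)
      (fps_scale s^-1 (fps_dilate s
        (fun j => if j is 0 then 0 else phi j / j`!%:R)))) n.
Proof.
(* Total weight of the enriched blocks on a set of size [j]; it vanishes at 0 because blocks are
   nonempty. *)
pose omega j := if j is i.+1 then s ^+ i * phi j else 0.
pose sp := structured_partition (fst : E -> {set T}) (@is_eblock gT n).
have neq0 (e : E) : is_eblock e -> e.1 != set0 by case/andP.
have s_neq0 : s != 0 by rewrite pnatr_eq0 -lt0n; apply/card_gt0P; exists 1%g.
have fact_neq0 j : j`!%:R != 0 :> K by rewrite pnatr_eq0 -lt0n fact_gt0.
have sum_omega B :
    \sum_(e : E | is_eblock e && (e.1 == B)) phi #|e.1| = omega #|B|.
  rewrite (eq_bigl (mem [set e : E | is_eblock e && (e.1 == B)])) => [|e]; last first.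
    by rewrite /= inE.
  rewrite (eq_bigr (fun=> phi #|B|)) => [|e]; last first.
    by rewrite /= inE => /andP[_ /eqP->].
  rewrite sumr_const card_eblock /omega.
  by case: #|B| => [|j]; rewrite ?mulr0n // -mulr_natl natrX.
have -> : fps_scale s^-1 (fps_dilate s
    (fun j => if j is 0 then 0 else phi j / j`!%:R)) = fun j => omega j / j`!%:R.
  apply/funext => -[|j]; rewrite /fps_scale /fps_dilate /= ?mulr0 ?mul0r //.
  by rewrite exprS -!mulrA mulKf // mulrA.
pose W (x : {set E} * {set T}) := kappa #|x.2| *
  (\prod_(e in x.1) phi #|e.1|) * g #|x.1|.
transitivity (\sum_(x | is_dowling x) W x).
  rewrite -(big_subtype _ (dowling gT n) W); apply: eq_bigr => y _.
  rewrite /dowling_b /dowling_a /W /= -/(zero_block y) -/(nonzero_blocks y).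
  have /structured_partitionP[yV _ _] : sp (nonzero_blocks y) (~: zero_block y).
    exact: valP y.
  have sz : {in nonzero_blocks y, forall e : E, (0 < #|e.1| <= n)%N}.
    move=> e ye; rewrite card_gt0 neq0 /=; last exact: yV.
    by rewrite -[leqRHS]card_ord max_card.
  have /= <- := big_card_fiber *%R phi sz.
  have /= := big_card_fiber addn (fun=> 1%N) sz; rewrite [in RHS]sum1_card => <-.
  congr (_ * _ * g _); last by apply: eq_bigr => i _; rewrite sum1_card.
  by apply: eq_bigr => i _; rewrite prodr_const.
transitivity (\sum_(Z : {set T}) \sum_(X | sp X (~: Z)) W (X, Z)).
  rewrite (exchange_big_dep predT) //= pair_big_dep /=.
  by apply: eq_big => -[].
pose comp := fps_comp (fun m => g m / m`!%:R) (fun j => omega j / j`!%:R).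
(* Contribution of one zero block of size [j]: the exponential formula is applied to its
   complement. *)
pose u j := kappa j * ((n - j)`!%:R * comp (n - j)%N).
transitivity (\sum_(Z in powerset [set: T]) u #|Z|).
  apply: eq_big => [Z|Z _]; first by rewrite inE subsetT.
  have cZ : #|~: Z| = (n - #|Z|)%N by rewrite cardsCs setCK card_ord.
  (* Sorting by the number of blocks, which is at most [#|~: Z|], so [inord] does not alter it. *)
  rewrite (partition_big (fun X : {set E} => inord #|X| : 'I_#|~: Z|.+1) predT) //=.
  rewrite /u /comp /fps_comp -cZ !mulr_sumr; apply: eq_bigr => m _.
  transitivity (kappa #|Z| * g m *
    structured_sum fst (@is_eblock gT n) (fun e : E => phi #|e.1|) (~: Z) m).
    rewrite /structured_sum mulr_sumr; apply: eq_big => [X|X].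
      rewrite -/sp; case: (boolP (sp X _)) => //= spX.
      rewrite -(inj_eq val_inj) /= inordK // ltnS.
      by rewrite (structured_partition_card neq0 spX).
    case/andP=> spX /eqP <-.
    rewrite inordK ?ltnS ?(structured_partition_card neq0 spX) //.
    by rewrite /W /= mulrAC.
  rewrite (structured_sumE neq0 sum_omega).
  by ring.
rewrite sum_powerset_card cardsT card_ord mulr_sumr; apply: eq_bigr => j _.
rewrite -/comp -(bin_fact (ltn_ord j : j <= n)%N) !natrM /u.
have := fact_neq0 j; move: (j`!%:R) => x x0.
by field.
Qed.
End DowlingSum.

(** * Counting minimal elements of posets, lower ideals and products *)

Section MinimalElements.
Local Open Scope order_scope.

Lemma minimalP d (P : finPOrderType d) (x : P) :
  reflect (forall y, y <= x -> y = x) (minimal x).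
Proof.
apply: (iffP forallP) => xmin y; last by apply/implyP => /xmin ->.
by move=> yx; apply/eqP; have := xmin y; rewrite yx.
Qed.

Lemma nb_minimal_gt0 d (P : finPOrderType d) (t : P) : (0 < nb_minimal P)%N.
Proof.
pose down (y : P) := [set z | z <= y].
(* An element with the fewest elements below it is minimal. *)
case: (@arg_minnP _ t predT (fun y => #|down y|) isT) => m _ mmin.
apply/card_gt0P; exists m; rewrite inE; apply/minimalP => y ym.
have ym_sub : down y \subset down m.
  by apply/subsetP => z; rewrite !inE => /le_trans; apply.
have: m \in down m by rewrite inE.
suff /eqP <- : down y == down m by rewrite inE => my; apply/le_anti; rewrite ym.
by rewrite eqEcard ym_sub mmin.
Qed.

Lemma nb_minimal_iso d d' (P : finPOrderType d) (P' : finPOrderType d') :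
  order_iso P P' -> nb_minimal P = nb_minimal P'.
Proof.
case=> h [h' hK h'K] hmono.
rewrite /nb_minimal -(card_imset _ (can_inj hK)); apply: eq_card => y.
rewrite -[y]h'K (mem_imset _ _ (can_inj hK)) !inE.
apply/minimalP/minimalP => xmin z; last by rewrite -hmono => /xmin/(can_inj hK).
by rewrite -[z]h'K hmono => /xmin ->.
Qed.

Lemma nb_minimal_lower_ideal d (P : finPOrderType d) (x : P) :
  nb_minimal (lower_ideal x) = #|[set m | minimal m && (m <= x)]|.
Proof.
rewrite /nb_minimal -(card_imset _ val_inj); apply: eq_card => m.
rewrite inE; apply/imsetP/andP => [[y + ->]|[mmin mx]].
  rewrite inE => /minimalP ymin; have yx : val y <= x := valP y.
  split=> //; apply/minimalP => z zy.
  by move/(congr1 val): (ymin (LowerIdeal (le_trans zy yx)) zy).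
exists (LowerIdeal mx) => //; rewrite inE; apply/minimalP => y ym.
by apply/val_inj/(minimalP _ mmin).
Qed.

Lemma nb_minimal_prod d d' (P : finPOrderType d) (P' : finPOrderType d') :
  nb_minimal (P *p P')%type = (nb_minimal P * nb_minimal P')%N.
Proof.
rewrite /nb_minimal -cardsX; apply: eq_card => -[x y]; rewrite !inE /=.
apply/minimalP/andP => [xymin|[/minimalP xmin /minimalP ymin] [x' y']].
  split; apply/minimalP => z zle.
    by have := xymin (z, y); rewrite leEprod /= zle lexx => /(_ isT)[].
  by have := xymin (x, z); rewrite leEprod /= zle lexx => /(_ isT)[].
by rewrite leEprod /= => /andP[/xmin -> /ymin ->].
Qed.

Lemma nb_minimal_prod_poset d (I : finType) (T : I -> finPOrderType d) :
  nb_minimal (prod_poset T) = (\prod_i nb_minimal (T i))%N.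
Proof.
transitivity #|(family (fun i (x : T i) => minimal x) :
    simpl_pred {dffun forall i, T i})|; last first.
  rewrite card_family foldrE big_image /=.
  by apply: eq_bigr => i _; apply: eq_card => x; rewrite inE.
apply: eq_card => u; rewrite inE.
apply/minimalP/familyP => [umin i|umin v /forallP vu]; last first.
  by apply/ffunP => i; apply: (minimalP _ (umin i)).
apply/minimalP => y yu.
(* Replacing coordinate [i] of [u] by [y] gives an element below [u], hence equal to [u]. *)
have := umin [ffun j => dfwith u y j : T j] => /(_ _)/ffunP/(_ i).
rewrite ffunE dfwith_in; apply.
by apply/forallP => j; rewrite ffunE; case: dfwithP.
Qed.

Lemma nb_minimal_power_product d (Q : nat -> finPOrderType d) n a :
  nb_minimal (power_product Q n a) =
  (\prod_(1 <= i < n.+1) nb_minimal (Q i) ^ a i)%N.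
Proof.
rewrite nb_minimal_prod_poset big_add1 big_mkord.
rewrite -(@sig_big_dep _ _ _ _ (fun i : 'I_n => 'I_(a i.+1)) predT
  (fun=> predT) (fun i _ => nb_minimal (Q i.+1))) /=.
by apply: eq_bigr => i _; rewrite prod_nat_const card_ord.
Qed.

End MinimalElements.

Theorem theorem3p6 (RR : realType) (gT : finGroupType)
    (dQ dR : Order.disp_t)
    (Q : nat -> finPOrderType dQ) (R : nat -> finPOrderType dR)
    (tb : forall n, R n -> nat) (ta : forall n, R n -> nat -> nat)
    (hQ : exponential_structure Q)
    (hR : exponential_dowling_structure gT Q tb ta)
    (f g k : nat -> RR[i]) :
  let s : RR[i] := #|gT|%:R in
  let M n := nb_minimal (Q n) in
  let N n := nb_minimal (R n) in
  let h n : RR[i] :=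
    \sum_(x : R n) k (tb n x) * (\prod_(1 <= i < n.+1) f i ^+ ta n x i)
                   * g (\sum_(1 <= i < n.+1) ta n x i)%N in
  let F n : RR[i] := if n is 0 then 0 else f n / (M n * n`!)%:R in
  let G n : RR[i] := g n / n`!%:R in
  let K n : RR[i] := k n / (N n * n`!)%:R in
  let H n : RR[i] := h n / (N n * n`!)%:R in
  H =1 fps_mul K (fps_comp G (fps_scale s^-1 (fps_dilate s F))).
Proof.
move=> s M N h F G K H n.
have N0 m : (N m)%:R != 0 :> RR[i].
  by rewrite pnatr_eq0 -lt0n; have [t _] := dow_top hR m; apply: nb_minimal_gt0 t.
(* [Q 0] is a dummy and may be empty; the products over types start at 1. *)
have M0 m : (0 < m)%N -> (M m)%:R != 0 :> RR[i].
  move=> m0; rewrite pnatr_eq0 -lt0n; have [t _] := exp_top hQ m0.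
  exact: nb_minimal_gt0 t.
(* These quotients absorb the number of minimal elements below an element into its weight. *)
pose kappa j := k j / (N j)%:R; pose phi j := f j / (M j)%:R.
pose W b (a : nat -> nat) := kappa b * (\prod_(1 <= i < n.+1) phi i ^+ a i) *
  g (\sum_(1 <= i < n.+1) a i)%N.
have hE : h n = (N n)%:R *
    \sum_(y : dowling gT n) W (dowling_b y) (dowling_a y).
  transitivity (\sum_(x : R n) \sum_(m | minimal m && (m <= x)%O)
      W (tb n x) (ta n x)).
    apply: eq_bigr => x _; rewrite sumr_const -cardsE -nb_minimal_lower_ideal.
    rewrite (nb_minimal_iso (dow_lower hR x)) nb_minimal_prod.
    rewrite nb_minimal_power_product -/(N _) -mulr_natl natrM natr_prod /W /kappa.
    transitivity (k (tb n x) * ((\prod_(1 <= i < n.+1) (M i ^ ta n x i)%:R) *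
      (\prod_(1 <= i < n.+1) phi i ^+ ta n x i)) *
      g (\sum_(1 <= i < n.+1) ta n x i)%N).
      rewrite -big_split /=; congr (_ * _ * _).
      rewrite !big_nat; apply: eq_bigr => i /andP[i0 _].
      by rewrite natrX -exprMn mulrC divfK ?M0.
    by field.
  (* After the exchange, each of the [N n] minimal [m] contributes the sum over its upper ideal,
     which [dow_type] identifies with the Dowling sum. *)
  rewrite (exchange_big_dep (@minimal _ (R n))) /= => [|x m _ /andP[]//].
  rewrite /N mulr_natl -sumr_const; apply: eq_big => [m|m mmin].
    by rewrite inE.
  have [phim [phim_bij _ typeE]] := dow_type hR mmin.
  under eq_bigl do rewrite mmin /=.
  transitivity (\sum_(x : upper_ideal m) W (tb n (val x)) (ta n (val x))).
    exact/esym/(big_subtype _ (upper_ideal m) (fun x => W (tb n x) (ta n x))).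
  rewrite (reindex phim) /=; last exact: onW_bij.
  apply: eq_bigr => y _; have [-> taE] := typeE y.
  by rewrite /W; congr (_ * _ * g _); apply: eq_big_nat => i /taE ->.
have FE : F = fun j => if j is 0 then 0 else phi j / j`!%:R.
  by apply/funext => -[|j] //; rewrite /F natrM invfM mulrA.
have KE : K = fun j => kappa j / j`!%:R.
  by apply/funext => j; rewrite /K natrM invfM mulrA.
rewrite /H hE dowling_sumE FE KE natrM; field.
by rewrite N0 pnatr_eq0 -lt0n fact_gt0.
Qed.
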